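(* Let $(u_n)_{n\ge 0}$, $(v_n)_{n\ge 0}$ and $(\nu_n)_{n\ge 0}$ be the sequences of real numbers defined by the recursions $$u_0=1,\qquad u_n=\frac{25(n-1)^2-1}{48}\,u_{n-1}-\frac12\sum_{k=1}^{n-1}u_k u_{n-k}\quad(n\ge 1),$$ $$v_0=-\sqrt3,\qquad v_n=\frac{1}{2\sqrt3}\left(-3u_{n/2}+\frac{5n-6}{2}\,v_{n-1}+\sum_{k=1}^{n-1}v_k v_{n-k}\right)\quad(n\ge 1),$$ where $u_{n/2}$ is understood to be $0$ if $n$ is odd, and $$\nu_0=1,\qquad \nu_n=-\frac{4}{5n}\sum_{k=0}^{n-1}v_{n+1-k}\,\nu_k\quad(n\ge 1).$$ Put $A=\frac{8\sqrt3}{5}$. Then there exists a nonzero constant $S'\in\mathbb{C}$ such that, as $n\to\infty$, the sequence $(v_n)$ has the asymptotic expansion $$v_n\sim (A/2)^{-n}\,\Gamma(n)\,\frac{S'}{2\pi i}\left\{1+\sum_{l=1}^{\infty}\frac{\nu_l\,(A/2)^l}{\prod_{m=1}^{l}(n-m)}\right\}.$$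
   Context: The asymptotic expansion is in the sense of Poincar\'e: for every integer $L\ge 0$, $$v_n=(A/2)^{-n}\,\Gamma(n)\,\frac{S'}{2\pi i}\left\{1+\sum_{l=1}^{L}\frac{\nu_l\,(A/2)^l}{\prod_{m=1}^{l}(n-m)}+O\!\left(n^{-L-1}\right)\right\}\qquad (n\to\infty).$$ Origin of the sequences: $u(z)=z^{1/2}\sum_{n\ge0}u_nz^{-5n/2}$ is the unique formal power series solution, asymptotic to $z^{1/2}$ for large $z>0$, of the Painlev\'e I equation $u^2-\frac16u''=z$; and $v(z)=z^{1/4}\sum_{n\ge0}v_nz^{-5n/4}$, with $v_0=-\sqrt3$, is the corresponding formal solution of the Riccati equation $2v'-v^2+3u=0$. *)

(* Defs.v *)
(* MathComp / MathComp-Analysis, with R[i] from mathcomp-real-closed. *)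
From HB Require Import structures.
From mathcomp Require Import all_boot all_order all_algebra.
From mathcomp Require Import all_classical all_reals all_analysis.
From mathcomp Require Import complex.

Set Implicit Arguments.
Unset Strict Implicit.
Unset Printing Implicit Defensive.

Import Order.TTheory GRing.Theory Num.Theory.
Import numFieldNormedType.Exports.
Local Open Scope ring_scope.

(* Euler's integral; `Rintegral` is 0 when the integral diverges (x <= 0). *)
Definition Gamma (R : realType) (x : R) : R :=
  \int[@lebesgue_measure R]_(t in `]0, +oo[%classic) (t `^ (x - 1) * expR (- t)).

Section Recursions.
Variable R : realType.
Implicit Types u v nu : nat -> R.

Definition u_recursion u : Prop :=
  u 0%N = 1 /\
  forall n, (1 <= n)%N ->
    u n = (25 * (n%:R - 1) ^+ 2 - 1) / 48 * u n.-1
          - 1 / 2 * \sum_(1 <= k < n) u k * u (n - k)%N.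

Definition v_recursion u v : Prop :=
  v 0%N = - Num.sqrt 3 /\
  forall n, (1 <= n)%N ->
    v n = 1 / (2 * Num.sqrt 3) *
          (- 3 * (if odd n then 0 else u n./2)
           + (5 * n%:R - 6) / 2 * v n.-1
           + \sum_(1 <= k < n) v k * v (n - k)%N).

Definition nu_recursion v nu : Prop :=
  nu 0%N = 1 /\
  forall n, (1 <= n)%N ->
    nu n = - (4 / (5 * n%:R)) * \sum_(0 <= k < n) v (n.+1 - k)%N * nu k.

Definition bigA : R := 8 * Num.sqrt 3 / 5.

(* The truncated factor 1 + sum_{l=1}^L ...; summands with l >= n involve
   a division by 0, which is irrelevant to the limit n -> oo. *)
Definition truncated_factor nu (L n : nat) : R :=
  1 + \sum_(1 <= l < L.+1)
        nu l * (bigA / 2) ^+ l / \prod_(1 <= m < l.+1) (n%:R - m%:R).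

End Recursions.

Arguments bigA {R}.

Section Poincare.
Local Open Scope classical_set_scope.
Local Open Scope complex_scope.

(* The error term e n is the O(n^{-L-1}) inside the braces. The equation is
   asked only for n large: Gamma and the summands are singular at small n.
   R[i]^o is R[i] as a normed module over itself, which Landau needs. *)
Definition asymptotic_expansion (R : realType) (v nu : nat -> R) (S' : R[i]) :
    Prop :=
  forall L : nat, exists e : nat -> R[i]^o,
    (e =O_\oo (fun n : nat => n%:R ^- L.+1 : R[i]^o)) /\
    (\forall n \near \oo,
       (v n)%:C =
       ((bigA / 2) ^- n * Gamma n%:R)%:C * (S' / (2 * pi%:C * 'i%C)) *
       ((truncated_factor nu L n)%:C + e n)).
End Poincare.

(* Main.v *)
Require Import Defs.
From mathcomp Require Import all_boot all_order all_algebra.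
From mathcomp Require Import all_classical all_reals all_analysis measurable_realfun.
From mathcomp Require Import complex.
From mathcomp Require Import ring lra zify.

Import Order.TTheory GRing.Theory Num.Theory numFieldNormedType.Exports.
Local Open Scope ring_scope.
Local Open Scope complex_scope.

(** Put [a = A / 2], [y n = a ^ (n+1) * v (n+1)] and [mu n = a ^ n * nu n].
    The Riccati recursion for [v] contains the products [v 1 * v (n-1)] twice;
    since [v 1 = 1 / 4], they combine with the linear term and turn its
    coefficient into exactly [(n-1) / a].  What remains is

      y (m+1) = (m+1) y m + kappa * sum_(0 < i < m) y i * y (m-i) + rho m,

    with [kappa = 1 / (2 sqrt 3)] and a source [rho] that comes from [u].  All
    terms are nonnegative, since [u m <= 0] for [m > 0].  Moreover [|u m|] is at
    most [(m!)^2 a^(-2m)], and since [u] enters at index [n / 2], its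
    contribution is [O((n - K)!)] for every [K]: it never shows in the expansion
    ([scaled_u_range], [riccati_source_le]).

    The ratio [w m = y m / m!] is positive and nondecreasing.  A crude
    induction gives [y m <= (m+1)! / 2].  Fed back into the convolution, whose
    mass is at its two ends, it gives [w (m+1) <= w m (1 + O(1 / m^2))], so [w]
    is bounded and tends to some [C > 0] ([ratio_cvg]).  The Stokes constant is
    [S' = 2 pi i C]; it is nonzero because [C >= w 1 > 0].

    The full expansion reads [y n = C * sum_(l <= L) mu l (n-l)! + O((n-L-1)!)]
    for every [L] ([factorial_expansion]).  It is proved by strong induction on
    [L].  Let [d n] be the difference of the two sides.  Up to
    [O((n-L-1)!)], the convolution is [2 * sum_(0 < i <= L) y i * y (n-i)], and
    the induction hypothesis at order [L - i] replaces each [y (n-i)] by a sum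
    of factorials.  The recursion of [mu] says exactly that all these factorials
    cancel in [d (n+1) - (n+1) d n], which is therefore [O((n-L-1)!)].  Divided by
    [(n+1)!], this is a telescoping bound on the increments of [d n / n!]; as
    [d n / n!] tends to 0, summation gives [d n = O((n-L-1)!)].

    The formula [Gamma (n+1) = n!] ([GammaS]) and the identity
    [prod_(0 < m <= l) (n+1-m) = n! / (n-l)!] translate this into the stated
    form. *)

(** * Euler's integral at positive integers *)

Section GammaIntegral.
Local Open Scope classical_set_scope.

Lemma cvgy_powMexpRN (R : realType) (n : nat) :
  (x ^+ n * expR (- x)) @[x --> +oo%R] --> (0 : R).
Proof.
apply/cvgrPdist_le => /= e e0.
near=> x.
have x0 : 0 < x by near: x; apply: nbhs_pinfty_gt; rewrite num_real.
have fx : n.+1`!%:R / e <= x.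
  by near: x; apply: nbhs_pinfty_ge; rewrite num_real.
rewrite sub0r normrN ger0_norm; last first.
  by rewrite mulr_ge0 ?expR_ge0 ?exprn_ge0 ?ltW.
have f0 : 0 < n.+1`!%:R :> R by rewrite ltr0n fact_gt0.
have h : x ^+ n.+1 / n.+1`!%:R <= expR x.
  by apply: le_trans (expR_ge1Dxn n (ltW x0)); rewrite lerDr.
rewrite expRN ler_pdivrMr ?expR_gt0//.
apply: le_trans (ler_wpM2l (ltW e0) h).
rewrite mulrCA exprSr -mulrA ler_peMr ?exprn_ge0 ?(ltW x0)//.
by rewrite mulrA ler_pdivlMr// mul1r; move: fx; rewrite ler_pdivrMr// [x * e]mulrC.
Unshelve. all: by end_near. Qed.

(** The recursion is integration by parts; as an explicit primitive, it reduces
    the improper integral to boundary values. *)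
Fixpoint Gamma_primitive (R : realType) (n : nat) (x : R) : R :=
  if n is m.+1 then n%:R * Gamma_primitive R m x - x ^+ n * expR (- x)
  else - expR (- x).

Lemma is_derive_Gamma_primitive (R : realType) n (x : R) :
  is_derive x 1 (Gamma_primitive R n) (x ^+ n * expR (- x)).
Proof.
elim: n => [|n IH] /=.
  by apply: is_derive_eq; rewrite /GRing.scale /=; ring.
have dE : is_derive x 1 (fun y : R => expR (- y)) (- expR (- x)).
  by apply: is_derive_eq; rewrite /GRing.scale /=; ring.
have dX : is_derive x 1 (fun y : R => y ^+ n.+1) (n.+1%:R * x ^+ n).
  rewrite (_ : (fun y : R => _) = id ^+ n.+1); last first.
    by apply/funext => y; rewrite exprfctE.
  by apply: is_derive_eq; rewrite /GRing.scale /= mulr1.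
apply: (@is_derive_eq _ _ _ (n.+1%:R \*: Gamma_primitive R n -
  (fun y : R => y ^+ n.+1) * (fun y : R => expR (- y)))).
by rewrite /GRing.scale /= exprS; ring.
Qed.

Lemma Gamma_primitive_cvgy (R : realType) n :
  Gamma_primitive R n x @[x --> +oo%R] --> (0 : R).
Proof.
elim: n => [|n IH] /=.
  by rewrite -oppr0; apply: cvgN; exact: cvgr_expR.
rewrite -[X in _ --> X](subr0 0) -{1}(mulr0 n.+1%:R).
by apply: cvgB; [apply: cvgMr|exact: cvgy_powMexpRN].
Qed.

Lemma Gamma_primitive0 (R : realType) n : Gamma_primitive R n 0 = - n`!%:R.
Proof.
elim: n => [|n IH] /=; first by rewrite oppr0 expR0.
by rewrite IH exprS !mul0r subr0 mulrN -natrM.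
Qed.

(** The primitive vanishes at infinity and equals [- n!] at [0]. *)
Lemma GammaS (R : realType) (n : nat) : Gamma (n.+1%:R : R) = n`!%:R.
Proof.
have cf : continuous (fun x : R => x ^+ n * expR (- x)).
  move=> x; apply: cvgM; first exact: exprn_continuous.
  apply: continuous_comp; first exact: continuousN.
  exact: continuous_expR.
have cF : continuous (Gamma_primitive R n).
  move=> x; apply: differentiable_continuous.
  apply/derivable1_diffP.
  by have [] := is_derive_Gamma_primitive R n x.
transitivity (fine (\int[@lebesgue_measure R]_(t in `[0, +oo[)
   (t ^+ n * expR (- t))%:E)).
  rewrite /Gamma /Rintegral -integral_itv_obnd_cbnd; last first.
    apply/measurable_EFinP; apply: measurable_funTS.
    exact: continuous_measurable_fun.
  congr fine; apply: eq_integral => x; rewrite inE/= in_itv/= andbT => x0.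
  by rewrite -(@natrB _ n.+1 1)// subn1/= powR_mulrn// ltW.
rewrite (@ge0_continuous_FTC2y _ _ (Gamma_primitive R n) 0 0).
- by rewrite Gamma_primitive0 -EFinB opprK add0r.
- by move=> x x0; rewrite mulr_ge0 ?expR_ge0 ?exprn_ge0.
- by apply: continuous_subspaceT.
- exact: Gamma_primitive_cvgy.
- by move=> x _; have [] := is_derive_Gamma_primitive R n x.
- by apply: cvg_at_right_filter; exact: cF.
- move=> x _; rewrite derive1E.
  by have [] := is_derive_Gamma_primitive R n x.
Qed.

End GammaIntegral.

(** * Sums and products of factorials *)

Section FactorialProducts.
Local Open Scope nat_scope.

(** Each of the [i] extra factors on the left is at most the matching one on the
    right. *)
Lemma fact_mul_shift a b i : a <= b -> (a + i)`! * b`! <= a`! * (b + i)`!.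
Proof.
move=> ab; elim: i => [|i IH]; first by rewrite !addn0.
rewrite !addnS !factS mulnCA -mulnA leq_mul// ltnS leq_add2r//.
Qed.

Lemma fact_mul_le K N j : K <= j -> j + K <= N ->
  j`! * (N - j)`! <= K`! * (N - K)`!.
Proof.
move=> Kj jN; have := @fact_mul_shift K (N - j) (j - K).
have -> : K + (j - K) = j by lia.
have -> : N - j + (j - K) = N - K by lia.
by apply; lia.
Qed.

(** The two end terms dominate: each of the other, fewer than [N - K], terms is
    at most [(K+1)! (N-K-1)!], so that together they weigh no more than
    [(K+1)!/K!] end terms. *)
Lemma sum_fact_mul_le K N :
  \sum_(K <= j < (N - K).+1) j`! * (N - j)`! <=
  (2 * K`! + K.+1`!) * (N - K)`!.
Proof.
have [NK|KN] := leqP (N - K).+1 K; first by rewrite big_geq.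
rewrite big_ltn//; have [E|KN'] := eqVneq (N - K) K.
  by rewrite E big_geq// addn0 leq_mul//; lia.
have KN2 : K.+1 <= N - K by lia.
rewrite big_nat_recr//=.
have -> : N - (N - K) = K by lia.
suff : \sum_(K.+1 <= i < N - K) i`! * (N - i)`! <= K.+1`! * (N - K)`! by lia.
apply: (@leq_trans (\sum_(K.+1 <= i < N - K) (K.+1`! * (N - K.+1)`!))).
  rewrite big_nat_cond [leqRHS]big_nat_cond.
  by apply: leq_sum => i /andP[/andP[i1 i2] _]; apply: fact_mul_le; lia.
rewrite sum_nat_const_nat.
have -> : N - K = (N - K.+1).+1 by lia.
by rewrite factS mulnCA leq_mul2l leq_mul// ?orbT//; lia.
Qed.

End FactorialProducts.

Lemma sum_triangle (V : nmodType) (F : nat -> nat -> V) L :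
  \sum_(0 <= m < L.+1) \sum_(0 <= l < m) F (m - l)%N l =
  \sum_(1 <= i < L.+1) \sum_(0 <= l < L.+1 - i) F i l.
Proof.
elim: L => [|L IH]; first by rewrite big_nat1 !big_geq.
rewrite big_nat_recr//= IH.
rewrite (_ : \sum_(0 <= l < L.+1) _ = \sum_(1 <= i < L.+2) F i (L.+1 - i)%N).
  rewrite 2?(big_nat_recr L.+1 1%N)//= addrA.
  congr +%R; last by rewrite subnn subSnn big_nat1.
  rewrite -big_split/= big_nat_cond [RHS]big_nat_cond.
  apply: eq_bigr => i /andP[/andP[i1 i2] _].
  by rewrite (subSn (ltnW i2)) [RHS]big_nat_recr.
rewrite big_add1/= big_nat_rev/= add0n.
by apply: eq_big_nat => i /andP[_ iL]; congr F; lia.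
Qed.

(** The product of the factors [1 + D / (m (m+1))] converges.  Without products:
    [M (1 - D / m)], positive for [m > D], is a supersolution of the recursion. *)
Lemma bounded_of_ratio (R : realType) (w : nat -> R) (D : R) (m0 : nat) :
  (0 < m0)%N -> 0 <= D ->
  (forall m, (m0 <= m)%N -> 0 <= w m) ->
  (forall m, (m0 <= m)%N ->
    w m.+1 <= w m * (1 + D / (m%:R * m.+1%:R))) ->
  exists M, forall m, (m0 <= m)%N -> w m <= M.
Proof.
move=> m00 D0 w0 wr.
pose m1 := maxn m0 (Num.truncn D).+2.
have Dm1 : D + 1 <= m1%:R.
  apply: (@le_trans _ _ (Num.truncn D).+2%:R); last by rewrite ler_nat leq_maxr.
  by rewrite -addn1 natrD lerD2r ltW// truncnS_gt.
(* With [D + 1 <= m1], this constant satisfies [w m1 <= M (1 - D / m1)]. *)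
pose M := w m1 * m1%:R.
have M0 : 0 <= M by rewrite mulr_ge0// w0// leq_maxl.
have H m : (m1 <= m)%N -> w m <= M * (1 - D / m%:R).
  elim: m => [|m IH]; first by rewrite leqn0 => /eqP E; lia.
  rewrite leq_eqVlt => /predU1P[<-|].
    rewrite -mulrA ler_peMr ?w0 ?leq_maxl//.
    have m1n0 : m1%:R != 0 :> R by rewrite pnatr_eq0; lia.
    by rewrite mulrBr mulr1 mulrCA divff// mulr1; lra.
  rewrite ltnS => m1m; have m0m : (m0 <= m)%N by rewrite (leq_trans (leq_maxl _ _) m1m).
  have mp : 0 < m%:R :> R by rewrite ltr0n; lia.
  have mp1 : 0 < m.+1%:R :> R by rewrite ltr0n.
  apply: le_trans (wr _ m0m) _.
  apply: (@le_trans _ _ (M * (1 - D / m%:R) * (1 + D / (m%:R * m.+1%:R)))).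
    rewrite ler_wpM2r ?IH// addr_ge0// divr_ge0// mulr_ge0// ltW//.
  rewrite -mulrA ler_wpM2l//.
  have -> : 1 - D / m.+1%:R = (1 - D / m%:R) + D / (m%:R * m.+1%:R).
    by rewrite -(natr1 m); field; rewrite natr1 !gt_eqF.
  rewrite mulrDr mulr1 lerD2l ler_piMl ?divr_ge0 ?mulr_ge0 ?(ltW mp) ?(ltW mp1)//.
  by rewrite gerBl divr_ge0// ltW.
exists (M + \sum_(0 <= i < m1) `|w i|) => m mm.
have [m1m|mm1] := leqP m1 m.
  apply: le_trans (H m m1m) _; rewrite -[leLHS]addr0 lerD ?sumr_ge0//.
  by rewrite ler_piMr// gerBl divr_ge0.
rewrite -[leLHS]add0r lerD// (bigD1_seq m)/= ?mem_index_iota ?iota_uniq//.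
by rewrite -[leLHS]addr0 lerD ?ler_norm ?sumr_ge0.
Qed.

(** * Factorial orders of magnitude *)

(** [f n = O((n - j)!)]. The truncated subtraction is harmless, since only large
    [n] matter. *)
Definition fact_bigO (R : realType) (j : nat) (f : nat -> R) : Prop :=
  exists M : R, exists N : nat, forall n, (N <= n)%N ->
    `|f n| <= M * ((n - j)`!)%:R.

Section FactBigO.
Variable R : realType.
Implicit Types (f g : nat -> R) (i j : nat).

Lemma fact_bigO_ge0 j f : fact_bigO R j f ->
  exists2 M : R, 0 <= M & exists N : nat, forall n, (N <= n)%N ->
    `|f n| <= M * ((n - j)`!)%:R.
Proof.
move=> [M [N H]]; exists `|M| => //; exists N => n Nn.
by apply: le_trans (H n Nn) _; rewrite ler_wpM2r// ler_norm.
Qed.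

Lemma fact_bigO_eventually j f g N : (forall n, (N <= n)%N -> f n = g n) ->
  fact_bigO R j f -> fact_bigO R j g.
Proof.
move=> fg [M [N' H]]; exists M, (maxn N N') => n; rewrite geq_max => /andP[n1 n2].
by rewrite -fg// H.
Qed.

Lemma fact_bigO0 j : fact_bigO R j (fun=> 0).
Proof. by exists 0, 0%N => n _; rewrite normr0 mul0r. Qed.

Lemma fact_bigOD j f g : fact_bigO R j f -> fact_bigO R j g ->
  fact_bigO R j (fun n => f n + g n).
Proof.
move=> [M [N Hf]] [M' [N' Hg]]; exists (M + M'), (maxn N N') => n.
rewrite geq_max => /andP[n1 n2].
by rewrite mulrDl (le_trans (ler_normD _ _))// lerD ?Hf ?Hg.
Qed.

Lemma fact_bigOZ j f (c : R) : fact_bigO R j f ->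
  fact_bigO R j (fun n => c * f n).
Proof.
move=> [M [N Hf]]; exists (`|c| * M), N => n Nn.
by rewrite normrM -mulrA ler_wpM2l// Hf.
Qed.

Lemma fact_bigO_sum j (s : seq nat) (f : nat -> nat -> R) :
  (forall i, i \in s -> fact_bigO R j (f i)) ->
  fact_bigO R j (fun n => \sum_(i <- s) f i n).
Proof.
elim: s => [|i s IH] H.
  apply: (@fact_bigO_eventually _ (fun=> 0) _ 0%N); last exact: fact_bigO0.
  by move=> n _; rewrite big_nil.
apply: (@fact_bigO_eventually _ (fun n => f i n + \sum_(k <- s) f k n) _ 0%N).
  by move=> n _; rewrite big_cons.
apply: fact_bigOD; first by apply: H; rewrite mem_head.
by apply: IH => k ks; apply: H; rewrite in_cons ks orbT.
Qed.

Lemma fact_bigO_shift i j f : fact_bigO R j f ->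
  fact_bigO R (j + i) (fun n => f (n - i)%N).
Proof.
move=> [M [N Hf]]; exists M, (N + i)%N => n Nn.
by rewrite addnC subnDA Hf//; lia.
Qed.

Lemma fact_bigO_fact j : fact_bigO R j (fun n => ((n - j)`!)%:R).
Proof. by exists 1, 0%N => n _; rewrite mul1r ger0_norm. Qed.

Lemma fact_bigO_le i j f : (j <= i)%N -> fact_bigO R i f -> fact_bigO R j f.
Proof.
move=> ji /fact_bigO_ge0[M M0 [N H]]; exists M, N => n Nn.
by apply: le_trans (H n Nn) _; rewrite ler_wpM2l// ler_nat leq_fact//; lia.
Qed.

End FactBigO.

Section Telescoping.
Local Open Scope classical_set_scope.

Lemma telescoping_bound (R : realType) (x h : nat -> R) (M : R) (N : nat) :
  0 <= M -> (forall n, 0 <= h n) ->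
  x n @[n --> \oo] --> (0 : R) ->
  (forall n, (N <= n)%N -> `|x n.+1 - x n| <= M * (h n - h n.+1)) ->
  forall n, (N <= n)%N -> `|x n| <= M * h n.
Proof.
move=> M0 h0 x0 H n Nn.
have K p : `|x (n + p)%N - x n| <= M * (h n - h (n + p)%N).
  elim: p => [|p IH]; first by rewrite addn0 !subrr mulr0 normr0.
  have -> : x (n + p.+1)%N - x n =
      (x (n + p).+1 - x (n + p)%N) + (x (n + p)%N - x n).
    by rewrite addnS; ring.
  apply: le_trans (ler_normD _ _) _.
  have := lerD (H (n + p)%N (leq_trans Nn (leq_addr _ _))) IH.
  by move=> /le_trans; apply; rewrite addnS -mulrDr addrC subrKA.
have cx : `|x (n + p)%N - x n| @[p --> \oo] --> `|0 - x n|.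
  apply: cvg_norm; apply: cvgB; last exact: cvg_cst.
  rewrite (_ : (fun p => x (n + p)%N) = (fun p => x (p + n)%N)).
    by move: x0; rewrite -(cvg_shiftn n).
  by apply/funext => p; rewrite addnC.
rewrite -normrN -sub0r.
apply: (cvgr_to_le cx); apply: nearW => p.
by apply: le_trans (K p) _; rewrite ler_wpM2l// gerBl.
Qed.

(** The operator [d |-> d (n+1) - (n+1) d n] is inverted without loss.  With
    [h n = (n-L-1)! / n!] one has
    [(h n - h (n+1)) (n+1)! = (L+1) (n-L-1)!], so the hypothesis bounds the
    increments of [d n / n!] by those of [M h]; the limit [0] excludes the kernel
    of the operator, spanned by [n!]. *)
Lemma fact_bigO_of_defect (R : realType) (L : nat) (d : nat -> R) :
  (d n / n`!%:R) @[n --> \oo] --> (0 : R) ->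
  fact_bigO R L.+1 (fun n => d n.+1 - n.+1%:R * d n) ->
  fact_bigO R L.+1 d.
Proof.
move=> d0 /fact_bigO_ge0[M M0 [N H]].
pose h n : R := (n - L.+1)`!%:R / n`!%:R.
exists M, (maxn N L.+1) => n nN.
have f0 k : 0 < k`!%:R :> R by rewrite ltr0n fact_gt0.
have := @telescoping_bound R (fun n => d n / n`!%:R) h M (maxn N L.+1) M0.
have hh k : 0 <= h k by rewrite divr_ge0.
move=> /(_ hh d0) => T.
suff : `|d n / n`!%:R| <= M * h n.
  rewrite normrM normfV (ger0_norm (ltW (f0 n))) /h mulrA.
  by rewrite ler_pM2r ?invr_gt0.
apply: T => // m; rewrite geq_max => /andP[Nm Lm].
have -> : d m.+1 / m.+1`!%:R - d m / m`!%:R =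
    (d m.+1 - m.+1%:R * d m) / m.+1`!%:R.
  by rewrite factS natrM; field; rewrite !gt_eqF//= ltr0n.
rewrite normrM normfV (ger0_norm (ltW (f0 _))) ler_pdivrMr//.
apply: le_trans (H m Nm) _; rewrite -mulrA ler_wpM2l//.
have -> : (h m - h m.+1) * m.+1`!%:R = L.+1%:R * (m - L.+1)`!%:R.
  have E : (m.+1 - L.+1 = (m - L.+1).+1)%N by rewrite subSn.
  have E2 : m.+1%:R = L.+1%:R + (m - L.+1).+1%:R :> R by rewrite -natrD; congr _%:R; lia.
  rewrite /h E !factS !natrM mulrBl.
  have -> : (m - L.+1)`!%:R / m`!%:R * (m.+1%:R * m`!%:R) = (m - L.+1)`!%:R * m.+1%:R :> R.
    by field; rewrite gt_eqF.
  rewrite divfK ?mulf_neq0 ?gt_eqF//.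
  by rewrite E2; ring.
by rewrite ler_peMl// ler1n.
Qed.

Lemma fact_bigO1_cvg (R : realType) (f : nat -> R) :
  fact_bigO R 1 f -> (f n / n`!%:R) @[n --> \oo] --> (0 : R).
Proof.
move=> [M [N H]]; apply/cvgrPdist_le => e e0; near=> n.
have n0 : (0 < n)%N by near: n; exists 1%N.
have Nn : (N <= n)%N by near: n; exists N.
have Mn : M / e <= n%:R by near: n; exact: nbhs_infty_ger.
have f0 k : 0 < k`!%:R :> R by rewrite ltr0n fact_gt0.
rewrite sub0r normrN normrM normfV (ger0_norm (ltW (f0 n))) ler_pdivrMr//.
apply: le_trans (H n Nn) _.
have -> : n`!%:R = n%:R * (n - 1)`!%:R :> R.
  by rewrite -natrM subn1 -[in LHS](prednK n0) factS prednK.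
rewrite mulrA ler_pM2r//.
by move: Mn; rewrite ler_pdivrMr// mulrC.
Unshelve. all: by end_near. Qed.

End Telescoping.

(** * Quadratic recursions with factorial growth *)

Definition fact_ratio (R : realType) (y : nat -> R) (m : nat) : R :=
  y m / m`!%:R.

Definition factorial_sum (R : realType) (mu : nat -> R) (L n : nat) : R :=
  \sum_(0 <= l < L.+1) mu l * (n - l)`!%:R.

Section QuadraticRecursion.
Local Open Scope classical_set_scope.
Variables (R : realType) (kappa : R) (y rho : nat -> R).
(* With [3 / 4] here and [1 / 25] in [rho_le], the induction step of
   [seq_le_factS] closes: [3 / 8 + 1 / 25 <= 1 / 2]. *)
Hypothesis kappa_range : 0 <= kappa <= 3 / 4.
Hypothesis y1_range : 0 < y 1%N <= 1.
Hypothesis y_rec : forall m, (0 < m)%N ->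
  y m.+1 = m.+1%:R * y m + kappa * \sum_(1 <= i < m) y i * y (m - i)%N + rho m.
Hypothesis rho_ge0 : forall m, (0 < m)%N -> 0 <= rho m.
Hypothesis rho_le : forall K m, (0 < m)%N -> (2 * K <= m + 2)%N ->
  rho m <= (K`! * (m + 2 - K)`!)%:R / 25.

Let f0 k : 0 < k`!%:R :> R. Proof. by rewrite ltr0n fact_gt0. Qed.
Let kappa0 : 0 <= kappa. Proof. by case/andP: kappa_range. Qed.

(** Only the linear term of the recursion is kept. *)
Lemma seq_ge_fact m : (0 < m)%N -> y 1%N * m`!%:R <= y m.
Proof.
have y10 : 0 <= y 1%N by case/andP: y1_range => /ltW.
elim/ltn_ind: m => -[//|[|m]] IH _; first by rewrite mulr1.
rewrite (y_rec m.+1)// factS natrM mulrCA -[leLHS]addr0 -[leLHS]addr0.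
rewrite lerD ?rho_ge0// lerD//.
  by rewrite ler_wpM2l// IH.
rewrite mulr_ge0// big_nat_cond sumr_ge0// => i /andP[/andP[i1 i2] _].
by apply: mulr_ge0; apply: le_trans (IH _ _ _); rewrite ?mulr_ge0//; lia.
Qed.

Lemma seq_gt0 m : (0 < m)%N -> 0 < y m.
Proof.
move=> m0; apply: lt_le_trans (seq_ge_fact m m0); rewrite mulr_gt0//.
by case/andP: y1_range.
Qed.

(** One factor [m+1] is given away compared with the true growth [m!]; this
    leaves room for the quadratic term without any numerical estimate, because
    each [(i+1)! (m-i+1)!] is at most [2 m!]. *)
Lemma seq_le_factS m : (0 < m)%N -> y m <= m.+1`!%:R / 2.
Proof.
elim/ltn_ind: m => -[//|[|m]] IH _.
  by rewrite divff//; case/andP: y1_range.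
rewrite (y_rec m.+1)//.
have IH1 : y m.+1 <= m.+2`!%:R / 2 by apply: IH.
have r1 : rho m.+1 <= m.+2`!%:R / 25.
  by have := @rho_le 1 m.+1 isT ltac:(lia); rewrite mul1n addn2 subn1.
have s1 : \sum_(1 <= i < m.+1) y i * y (m.+1 - i)%N <= m.+2`!%:R / 2.
  apply: (@le_trans _ _ (\sum_(1 <= i < m.+1) (m.+1`!%:R / 2))).
    rewrite big_nat_cond [leRHS]big_nat_cond.
    apply: ler_sum => i /andP[/andP[i1 i2] _].
    apply: (@le_trans _ _ ((i.+1`!%:R / 2) * ((m.+1 - i).+1`!%:R / 2))).
      apply: ler_pM; [by apply/ltW/seq_gt0; lia | by apply/ltW/seq_gt0; lia
        | by apply: IH; lia | by apply: IH; lia].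
    have := @fact_mul_le 2 (m + 3) i.+1 ltac:(lia) ltac:(lia).
    have -> : (m + 3 - i.+1 = (m.+1 - i).+1)%N by lia.
    have -> : (m + 3 - 2 = m.+1)%N by lia.
    rewrite -(ler_nat R) !natrM; lra.
  rewrite big_const_nat iter_addr_0 -[leLHS]mulr_natl subn1/= [in leRHS]factS natrM -mulrA.
  by rewrite ler_wpM2r ?divr_ge0// ler_nat; lia.
have e : m.+3`!%:R = m.+3%:R * m.+2`!%:R :> R by rewrite factS natrM.
have s2 := ler_wpM2l kappa0 s1.
have s3 : kappa * (m.+2`!%:R / 2) <= 3 / 4 * (m.+2`!%:R / 2).
  by apply: ler_wpM2r; [rewrite divr_ge0|case/andP: kappa_range].
have s4 := ler_wpM2l (ler0n R m.+2) IH1.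
have e' : m.+3%:R = m.+2%:R + 1 :> R by rewrite natr1.
rewrite e e' [(_ + 1) * _]mulrDl mul1r.
set S := \sum_(1 <= i < m.+1) _ in s1 s2 *.
move: (f0 m.+2) s4 s3 s2 r1; rewrite !mulrA.
set F := _`!%:R; set P := m.+2%:R * F; set Q := m.+2%:R * _.
set T := kappa * S; set T' := kappa * _.
lra.
Qed.

Local Notation w := (fact_ratio R y).

Lemma ratio_ge0 m : (0 < m)%N -> 0 <= w m.
Proof. by move=> m0; rewrite /fact_ratio divr_ge0// ltW// seq_gt0. Qed.

Lemma ratio_leS m : (0 < m)%N -> w m <= w m.+1.
Proof.
move=> m0; rewrite /fact_ratio ler_pdivlMr// factS natrM mulrCA divfK ?gt_eqF//.
rewrite y_rec// -addrA lerDl addr_ge0 ?rho_ge0// mulr_ge0//.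
rewrite big_nat_cond sumr_ge0// => i /andP[/andP[i1 i2] _].
by apply: mulr_ge0; rewrite ltW// seq_gt0//; lia.
Qed.

Lemma ratio_homo m n : (0 < m)%N -> (m <= n)%N -> w m <= w n.
Proof.
move=> m0; elim: n => [|n IH]; first by lia.
rewrite leq_eqVlt => /predU1P[->//|mn].
by apply: le_trans (IH mn) (ratio_leS _ _); lia.
Qed.

Lemma ratioK m : y m = w m * m`!%:R.
Proof. by rewrite /fact_ratio divfK ?gt_eqF. Qed.

Lemma ratio_le_half m : (0 < m)%N -> w m <= m.+1%:R / 2.
Proof.
move=> m0; rewrite /fact_ratio ler_pdivrMr//; have := seq_le_factS m m0.
by rewrite factS natrM mulrAC.
Qed.

(** With [j = m - i], the factor of smaller index is bounded by
    [min (i+1) (j+1) / 2] and the other one by monotonicity.  Since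
    [min (i+1) (j+1) <= 2 (i+1) (j+1) / (i+j+2)], one gets [w m / (m+2)] times
    [(i+1) (j+1)], which is absorbed by the factorials and keeps the estimate
    linear in [w]. *)
Lemma conv_term_le m i : (0 < i)%N -> (i < m)%N ->
  y i * y (m - i)%N <=
  w m / (m + 2)%:R * (i.+1`! * (m + 2 - i.+1)`!)%:R.
Proof.
move=> i0 im; pose j := (m - i)%N.
have j0 : (0 < j)%N by rewrite subn_gt0.
have eij : (m + 2)%:R = i.+1%:R + j.+1%:R :> R by rewrite -natrD; congr _%:R; lia.
have -> : (m + 2 - i.+1 = j.+1)%N by lia.
rewrite -/j !ratioK !factS !natrM.
have m2 : 0 < (m + 2)%:R :> R by rewrite ltr0n; lia.
have wi := ratio_le_half i i0; have wj := ratio_le_half j j0.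
have wim : w i <= w m by apply: ratio_homo; lia.
have wjm : w j <= w m by apply: ratio_homo; lia.
have wi0 := ratio_ge0 i i0; have wj0 := ratio_ge0 j j0.
have wm0 : 0 <= w m by apply/ratio_ge0/(leq_ltn_trans _ im).
suff : w i * w j <= w m / (m + 2)%:R * (i.+1%:R * j.+1%:R).
  move=> h; have := ler_wpM2r (mulr_ge0 (ltW (f0 i)) (ltW (f0 j))) h.
  by move=> h'; apply: le_trans (le_trans _ h') _; rewrite le_eqVlt; apply/orP; left; apply/eqP; ring.
rewrite [leRHS]mulrAC ler_pdivlMr// eij.
have i1 : 0 <= i.+1%:R :> R by []. have j1 : 0 <= j.+1%:R :> R by [].
have [ij|ji] := leP (i.+1%:R : R) j.+1%:R.
  have h1 := ler_pM wi0 wj0 wi wjm.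
  apply: (@le_trans _ _ (i.+1%:R / 2 * w m * (j.+1%:R + j.+1%:R))).
    apply: ler_pM => //; first exact: mulr_ge0.
    by rewrite lerD2r.
  by rewrite le_eqVlt; apply/orP; left; apply/eqP; field.
have h1 := ler_pM wi0 wj0 wim wj.
apply: (@le_trans _ _ (w m * (j.+1%:R / 2) * (i.+1%:R + i.+1%:R))).
  apply: ler_pM => //; first exact: mulr_ge0.
  by rewrite lerD2l ltW.
by rewrite le_eqVlt; apply/orP; left; apply/eqP; field.
Qed.

(** Summing [conv_term_le] bounds the convolution by [10 m! w m / (m+2)].  The
    source is at most [6 (m-1)! / 25], which [y 1 <= w m] turns into a multiple
    of [w m]. *)
Lemma ratio_growth m : (4 <= m)%N ->
  w m.+1 <= w m * (1 + (8 + (y 1%N)^-1) / (m%:R * m.+1%:R)).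
Proof.
move=> m4; have m0 : (0 < m)%N by lia.
have mp : 0 < m%:R :> R by rewrite ltr0n.
have mp1 : 0 < m.+1%:R :> R by rewrite ltr0n.
have y10 : 0 < y 1%N by case/andP: y1_range.
have wm0 := ratio_ge0 m m0.
have S1 : \sum_(1 <= i < m) y i * y (m - i)%N <=
    w m / (m + 2)%:R * (10 * m`!%:R).
  apply: (@le_trans _ _ (\sum_(1 <= i < m) w m / (m + 2)%:R *
    (i.+1`! * (m + 2 - i.+1)`!)%:R)).
    rewrite big_nat_cond [leRHS]big_nat_cond.
    by apply: ler_sum => i /andP[/andP[i1 i2] _]; exact: conv_term_le.
  rewrite -mulr_sumr ler_wpM2l//; first exact: divr_ge0.
  rewrite -natr_sum -natrM ler_nat.
  have := sum_fact_mul_le 2 (m + 2); rewrite big_add1/= addnK.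
  by rewrite (_ : 2 * 2`! + 3`! = 10)%N.
have S2 : \sum_(1 <= i < m) y i * y (m - i)%N <= 10 * (w m / m%:R * m`!%:R).
  apply: le_trans S1 _; rewrite mulrCA ler_wpM2l// ler_wpM2r//.
  by rewrite ler_wpM2l// lef_pV2 ?posrE ?ltr0n ?ler_nat; lia.
have S3 : kappa * \sum_(1 <= i < m) y i * y (m - i)%N <=
    8 * (w m / m%:R * m`!%:R).
  have : kappa * \sum_(1 <= i < m) y i * y (m - i)%N <= 3 / 4 * (10 * (w m / m%:R * m`!%:R)).
    apply: (le_trans (ler_wpM2l kappa0 S2)); apply: ler_wpM2r.
      by rewrite mulr_ge0// mulr_ge0// divr_ge0.
    by case/andP: kappa_range.
  have : 0 <= w m / m%:R * m`!%:R by rewrite mulr_ge0// divr_ge0.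
  lra.
have S4 : rho m <= (y 1%N)^-1 * (w m / m%:R * m`!%:R).
  have w1 : y 1%N <= w m by rewrite /fact_ratio ler_pdivlMr// seq_ge_fact.
  have [m3 m23] : (2 * 3 <= m + 2)%N /\ (m + 2 - 3 = m.-1)%N.
    by clear -m4; lia.
  have := rho_le 3 m m0 m3; rewrite m23.
  move=> h; apply: (le_trans h).
  have -> : w m / m%:R * m`!%:R = w m * (m.-1)`!%:R.
    by rewrite -[in m`!](prednK m0) factS natrM prednK//; field; rewrite gt_eqF.
  rewrite mulrA natrM mulrAC ler_wpM2r//.
  apply: (@le_trans _ _ 1); first by rewrite ler_pdivrMr// mul1r ler_nat.
  by rewrite ler_pdivlMl// mulr1.
rewrite [w m.+1]/fact_ratio ler_pdivrMr// y_rec//.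
have -> : w m * (1 + (8 + (y 1%N)^-1) / (m%:R * m.+1%:R)) * m.+1`!%:R =
   m.+1%:R * y m + 8 * (w m / m%:R * m`!%:R) + (y 1%N)^-1 * (w m / m%:R * m`!%:R).
  by rewrite (ratioK m) factS natrM; field; rewrite !gt_eqF.
by rewrite !lerD.
Qed.

Lemma ratio_bounded : exists M, forall m, (0 < m)%N -> w m <= M.
Proof.
have [] := @bounded_of_ratio R w (8 + (y 1%N)^-1) 4.
- by [].
- by rewrite addr_ge0// invr_ge0; case/andP: y1_range => /ltW.
- by move=> m m4; apply: ratio_ge0; lia.
- exact: ratio_growth.
move=> M HM; exists M => m m0.
have [m4|m4] := leqP 4 m; first exact: HM.
by apply: le_trans (HM 4%N isT); apply: ratio_homo => //; lia.
Qed.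

Lemma ratio_cvg : exists2 C : R, 0 < C & w n @[n --> \oo] --> C.
Proof.
have [M HM] := ratio_bounded.
have ndw : {homo (fun n => w n.+1) : n m / (n <= m)%N >-> n <= m}.
  by move=> n m nm; apply: ratio_homo.
have cw : cvgn (fun n => w n.+1).
  apply: nondecreasing_is_cvgn => //; exists M => _ [n _ <-]; exact: HM.
exists (limn (fun n => w n.+1)).
  apply: lt_le_trans (nondecreasing_cvgn_le ndw cw 0%N).
  by rewrite /fact_ratio divr_gt0// seq_gt0.
by rewrite -(cvg_shiftS w).
Qed.

(** The two ends of the convolution are equal by symmetry, and the middle part
    is controlled by [sum_fact_mul_le] since [y i = O(i!)]. *)
Lemma conv_two_ends L : fact_bigO R L.+1 (fun n =>
  \sum_(1 <= i < n) y i * y (n - i)%N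
  - 2 * \sum_(1 <= i < L.+1) y i * y (n - i)%N).
Proof.
have [M HM] := ratio_bounded.
have yM i : (0 < i)%N -> y i <= M * i`!%:R.
  by move=> i0; rewrite ratioK ler_wpM2r// HM.
exists (M * M * (2 * L.+1`! + L.+2`!)%:R), (2 * L + 2)%N => n nL.
rewrite (@big_cat_nat _ _ _ L.+1)//=; last by lia.
rewrite (@big_cat_nat _ _ _ (n - L) L.+1)//=; try lia.
have -> : \sum_(n - L <= i < n) y i * y (n - i)%N =
    \sum_(1 <= i < L.+1) y i * y (n - i)%N.
  have -> : (n - L = 1 + (n - L - 1))%N by lia.
  rewrite big_addn (_ : n - (n - L - 1) = L.+1)%N; last by lia.
  rewrite [RHS]big_nat_rev/=; apply: eq_big_nat => i i1.
  by rewrite mulrC; congr (y _ * y _); lia.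
set S := \sum_(1 <= i < L.+1) _; set T := \sum_(L.+1 <= i < n - L) _.
have -> : S + (T + S) - 2 * S = T by ring.
have T0 : 0 <= T.
  rewrite /T big_nat_cond sumr_ge0// => i /andP[/andP[i1 i2] _].
  by apply: mulr_ge0; apply/ltW/seq_gt0; lia.
rewrite ger0_norm//.
apply: (@le_trans _ _ (\sum_(L.+1 <= i < n - L) M * M * (i`! * (n - i)`!)%:R)).
  rewrite /T big_nat_cond [leRHS]big_nat_cond.
  apply: ler_sum => i /andP[/andP[i1 i2] _].
  rewrite natrM mulrACA; apply: ler_pM.
  - by apply/ltW/seq_gt0; lia.
  - by apply/ltW/seq_gt0; lia.
  - by apply: yM; lia.
  - by apply: yM; lia.
rewrite -mulr_sumr -[leRHS]mulrA ler_wpM2l//.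
  by rewrite -expr2 sqr_ge0.
rewrite -natr_sum -natrM ler_nat.
have := sum_fact_mul_le L.+1 n.
by rewrite (_ : (n - L.+1).+1 = n - L)%N//; lia.
Qed.

Variables (C : R) (mu : nat -> R).
Hypothesis w_cvgC : w n @[n --> \oo] --> C.
Hypothesis mu0 : mu 0%N = 1.
Hypothesis mu_rec : forall n, (0 < n)%N ->
  n%:R * mu n = - (2 * kappa) * \sum_(0 <= k < n) y (n - k)%N * mu k.

Local Notation s := (factorial_sum R mu).

(** Each [mu l (n-l)!] contributes [- l mu l (n-l)!] to the left-hand side.
    Expanding [l mu l] by its recursion and summing over the triangle
    [i + l <= L] along the other direction gives the convolution of [y] with the
    lower-order sums: the formal solution cancels to all orders. *)
Lemma factorial_sum_defect L n : (L < n)%N ->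
  s L n.+1 - n.+1%:R * s L n =
  2 * kappa * \sum_(1 <= i < L.+1) y i * s (L - i) (n - i).
Proof.
move=> Ln.
transitivity (\sum_(0 <= m < L.+1) - ((m%:R * mu m) * (n - m)`!%:R)).
  rewrite /factorial_sum mulr_sumr -sumrB; apply: eq_big_nat => l /andP[_ lL].
  have e : (n.+1 - l = (n - l).+1)%N by lia.
  have e2 : n.+1%:R = (n - l).+1%:R + l%:R :> R by rewrite -natrD; congr _%:R; lia.
  by rewrite e factS natrM e2; ring.
transitivity (2 * kappa *
    \sum_(0 <= m < L.+1) \sum_(0 <= l < m)
      (fun i l => y i * (mu l * (n - i - l)`!%:R)) (m - l)%N l).
  rewrite mulr_sumr; apply: eq_big_nat => -[|m] /andP[_ mL].
    by rewrite !mul0r oppr0 big_geq// mulr0.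
  rewrite mu_rec// !mulNr opprK -[LHS]mulrA; congr (_ * _).
  rewrite mulr_suml; apply: eq_big_nat => l /andP[_ lm] /=.
  by rewrite -mulrA (_ : n - (m.+1 - l) - l = n - m.+1)%N//; lia.
rewrite (sum_triangle _ (fun i l => y i * (mu l * (n - i - l)`!%:R))).
congr (_ * _); apply: eq_big_nat => i /andP[i1 iL].
by rewrite /factorial_sum mulr_sumr (_ : L.+1 - i = (L - i).+1)%N//; lia.
Qed.

Lemma sub_factorial_sum_cvg L :
  ((y n - C * s L n) / n`!%:R) @[n --> \oo] --> (0 : R).
Proof.
have -> : (fun n => (y n - C * s L n) / n`!%:R) =
    (fun n => w n - C - C * ((\sum_(1 <= l < L.+1) mu l * (n - l)`!%:R) / n`!%:R)).
  apply/funext => n; rewrite /factorial_sum big_ltn// mu0 subn0 mul1r /fact_ratio.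
  by field; rewrite gt_eqF.
have e0 : (0 : R) = C - C - C * 0 by ring.
rewrite [X in _ --> X]e0.
apply: cvgB; first by apply: cvgB => //; exact: cvg_cst.
apply: cvgMr; apply: fact_bigO1_cvg.
apply: fact_bigO_sum => l; rewrite mem_index_iota => /andP[l1 _].
apply: fact_bigOZ; apply: fact_bigO_le l1 _; exact: fact_bigO_fact.
Qed.

(** [e] is what the convolution leaves beyond its two ends, and [g] is what the
    induction hypotheses at the orders [L - i] leave of these ends. *)
Lemma factorial_expansion L : fact_bigO R L.+1 (fun n => y n - C * s L n).
Proof.
elim/ltn_ind: L => L IH.
apply: fact_bigO_of_defect; first exact: sub_factorial_sum_cvg.
pose e n := kappa * (\sum_(1 <= i < n) y i * y (n - i)%N
  - 2 * \sum_(1 <= i < L.+1) y i * y (n - i)%N).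
pose g n := \sum_(1 <= i < L.+1)
  (2 * kappa * y i) * (y (n - i)%N - C * s (L - i) (n - i)).
apply: (@fact_bigO_eventually _ _ (fun n => e n + rho n + g n) _ L.+1).
  move=> n Ln; rewrite y_rec; last by lia.
  have -> : g n = 2 * kappa * (\sum_(1 <= i < L.+1) y i * y (n - i)%N)
     - C * (s L n.+1 - n.+1%:R * s L n).
    rewrite factorial_sum_defect// /g mulrCA -mulrBr [C * _]mulr_sumr -sumrB mulr_sumr.
    by apply: eq_bigr => i _; ring.
  by rewrite /e; ring.
apply: fact_bigOD; first apply: fact_bigOD.
- exact/fact_bigOZ/conv_two_ends.
- exists (L.+3`!%:R / 25), (2 * L + 4)%N => n nL.
  have n0 : (0 < n)%N by lia.
  rewrite ger0_norm ?rho_ge0//; apply: le_trans (rho_le L.+3 n n0 _) _; first by lia.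
  by rewrite natrM mulrAC (_ : n + 2 - L.+3 = n - L.+1)%N//; lia.
- apply: fact_bigO_sum => i; rewrite mem_index_iota => /andP[i1 iL].
  apply: fact_bigOZ.
  have -> : L.+1 = ((L - i).+1 + i)%N by lia.
  by apply: (fact_bigO_shift R i _ (fun n => y n - C * s (L - i) n)); apply: IH; lia.
Qed.

End QuadraticRecursion.

(** * The Painleve I and Riccati recursions *)

(** The sign makes the terms of positive index nonnegative. *)
Definition scaled_u (R : realType) (u : nat -> R) (m : nat) : R :=
  - ((bigA / 2) ^+ m.*2 * u m).

(** The index is shifted so that the growth is [n!], matching
    [Gamma (n+1) = n!]. *)
Definition scaled_v (R : realType) (v : nat -> R) (n : nat) : R :=
  (bigA / 2) ^+ n.+1 * v n.+1.

Definition scaled_nu (R : realType) (nu : nat -> R) (n : nat) : R :=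
  (bigA / 2) ^+ n * nu n.

(** This is the term [- 3 u (n / 2)] of the Riccati recursion at [n = m + 2],
    divided by [2 sqrt 3] and rescaled. *)
Definition riccati_source (R : realType) (u : nat -> R) (m : nat) : R :=
  if odd m then 0 else Num.sqrt 3 / 2 * scaled_u R u (m./2).+1.

Section PainleveOne.
Variables (R : realType) (u v nu : nat -> R).
Hypothesis hu : u_recursion u.
Hypothesis hv : v_recursion u v.
Hypothesis hnu : nu_recursion v nu.

Local Notation q := (Num.sqrt 3 : R).
Local Notation a := (bigA / 2 : R).

Let qq : q * q = 3. Proof. by rewrite -expr2 sqr_sqrtr. Qed.
Let q0 : 0 < q. Proof. by rewrite sqrtr_gt0. Qed.
Let qn0 : q != 0. Proof. by rewrite gt_eqF. Qed.
Let q_le2 : q <= 2.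
Proof.
by rewrite -(@ler_pXn2r _ 2)// ?nnegrE ?(ltW q0)// expr2 qq; lra.
Qed.
Let q_ge1 : 1 <= q.
Proof. by rewrite -{1}(sqrtr1 R) ler_wsqrtr// ler1n. Qed.
Let aE : a = 4 * q / 5. Proof. by rewrite /bigA; field. Qed.
Let aa : a * a = 48 / 25.
Proof.
have -> : a * a = 16 / 25 * (q * q) by rewrite aE; field.
by rewrite qq; field.
Qed.

Local Notation p := (scaled_u R u).

Lemma scaled_u_rec n : (0 < n)%N ->
  p n = ((n%:R - 1) ^+ 2 - 1 / 25) * p n.-1
        + 1 / 2 * \sum_(1 <= k < n) p k * p (n - k)%N.
Proof.
case: n => // n _; have [_ ur] := hu.
rewrite {1}/scaled_u ur//= doubleS !exprS [a * (a * _)]mulrA aa mulrBr opprB addrC; congr (_ + _).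
  by rewrite /scaled_u; field.
rewrite mulrCA; congr (_ * _); rewrite mulr_sumr; apply: eq_big_nat => k /andP[k1 kn].
rewrite /scaled_u mulrNN [RHS]mulrACA -exprD -doubleD (_ : k + (n.+1 - k) = n.+1)%N; last by lia.
by rewrite doubleS !exprS [a * (a * _)]mulrA aa !mulrA.
Qed.

(** In [((n-1)^2 - 1/25) p (n-1)] the loss [1/25] is dropped; the gain from
    [(n-1)^2] to [n^2] pays for the quadratic term. *)
Lemma scaled_u_range n : (0 < n)%N -> 0 <= p n <= (n`! * n`!)%:R / 25.
Proof.
elim/ltn_ind: n => -[//|[|n]] IH _.
  rewrite scaled_u_rec// big_geq//= /scaled_u; have [-> _] := hu.
  rewrite expr0 !mulr1 subrr expr0n/= (_ : 1`! * 1`! = 1)%N//.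
  by apply/andP; split; lra.
rewrite scaled_u_rec//=.
have /andP[p0 p1] : 0 <= p n.+1 <= (n.+1`! * n.+1`!)%:R / 25 by apply: IH.
have N : 1 <= n.+1%:R :> R by rewrite ler1n.
have eN : n.+2%:R - 1 = n.+1%:R :> R by rewrite -natr1 addrK.
rewrite eN.
have s0 : 0 <= \sum_(1 <= k < n.+2) p k * p (n.+2 - k)%N.
  rewrite big_nat_cond sumr_ge0// => k /andP[/andP[k1 k2] _].
  have /andP[h1 _] := IH k k2 k1.
  have [nk1 nk2] : (n.+2 - k < n.+2)%N /\ (0 < n.+2 - k)%N.
    by clear -k1 k2; lia.
  have /andP[h2 _] := IH (n.+2 - k)%N nk1 nk2.
  exact: mulr_ge0.
have s1 : \sum_(1 <= k < n.+2) p k * p (n.+2 - k)%N <=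
    n.+1%:R * ((n.+1`! * n.+1`!)%:R / 25).
  apply: (@le_trans _ _ (\sum_(1 <= k < n.+2) ((n.+1`! * n.+1`!)%:R / 25))).
    rewrite big_nat_cond [leRHS]big_nat_cond.
    apply: ler_sum => k /andP[/andP[k1 k2] _].
    have [nk1 nk2] : (n.+2 - k < n.+2)%N /\ (0 < n.+2 - k)%N.
      by clear -k1 k2; lia.
    have /andP[h1 h2] := IH k k2 k1.
    have /andP[h3 h4] := IH (n.+2 - k)%N nk1 nk2.
    apply: (le_trans (ler_pM h1 h3 h2 h4)).
    have := @fact_mul_le 1 n.+2 k k1 ltac:(by rewrite addn1).
    rewrite (_ : 1`! = 1)%N// mul1n subn1/= => h5.
    have : (k`! * k`!)%:R * ((n.+2 - k)`! * (n.+2 - k)`!)%:R <=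
        (n.+1`! * n.+1`!)%:R :> R.
      by rewrite -natrM ler_nat mulnACA leq_mul.
    set X := (k`! * k`!)%:R; set Y := (_ * _)%:R; set T := (_ * _)%:R.
    have T0 : 0 <= T :> R by [].
    lra.
  by rewrite big_const_nat iter_addr_0 subn1/= -[leLHS]mulr_natl.
apply/andP; split.
  rewrite addr_ge0//; last by rewrite mulr_ge0.
  rewrite mulr_ge0// subr_ge0.
  have : 1 <= n.+1%:R ^+ 2 :> R by rewrite exprn_ege1.
  lra.
have eF : (n.+2`! * n.+2`!)%:R =
    (n.+1%:R + 1) * (n.+1%:R + 1) * (n.+1`! * n.+1`!)%:R :> R.
  rewrite natr1 -!natrM; congr _%:R.
  by rewrite [n.+2`!]factS mulnACA.
rewrite eF; set F := (n.+1`! * n.+1`!)%:R in p1 s1 *.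
have F0 : 0 <= F by [].
move: s1 p1 N; set S := \sum_(1 <= k < n.+2) _; set N := n.+1%:R => s1 p1 N1.
have N0 : 0 <= N * N by rewrite mulr_ge0.
have := ler_wpM2l N0 p1.
have NF : 0 <= N * F by rewrite mulr_ge0.
rewrite expr2; lra.
Qed.

Local Notation y := (scaled_v R v).
Local Notation kappa := (1 / (2 * q)).
Local Notation rho := (riccati_source R u).
Local Notation mu := (scaled_nu R nu).

Let v1 : v 1%N = 1 / 4.
Proof.
by have [v0 vr] := hv; rewrite vr//= big_geq// v0; field.
Qed.

Lemma scaled_v1 : y 1%N = q / 5.
Proof.
have [v0 vr] := hv; have [u0 ur] := hu.
rewrite /scaled_v vr//= big_nat1 subn1/= v1 ur//= u0 big_geq//.
have -> : q / 5 = (q * q) / (5 * q) by field.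
by rewrite expr2 aa qq; field.
Qed.

(** The end terms [v 1 * v (m+1)] of the convolution, with [v 1 = 1 / 4], change
    the linear coefficient [(5 m + 4) / 2] into [5 (m+1) / 2], and
    [5 a / (4 sqrt 3) = 1]. *)
Lemma scaled_v_rec m : (0 < m)%N ->
  y m.+1 = m.+1%:R * y m + kappa * \sum_(1 <= i < m) y i * y (m - i)%N + rho m.
Proof.
move=> m0; have [v0 vr] := hv.
rewrite {1}/scaled_v vr//=.
rewrite big_ltn// big_nat_recr/=; last by lia.
rewrite subn1 subSnn v1 /= negbK mulrA.
have -> : a ^+ m.+2 * (1 / (2 * q)) *
  (- 3 * (if odd m then 0 else u (m./2).+1) + (5 * m.+2%:R - 6) / 2 * v m.+1 +
   (1 / 4 * v m.+1 + (\sum_(2 <= i < m.+1) v i * v (m.+2 - i)%N + v m.+1 * (1 / 4)))) =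
  (a * 5 / (4 * q)) * (m.+1%:R * (a ^+ m.+1 * v m.+1))
  + 1 / (2 * q) * (a ^+ m.+2 * \sum_(2 <= i < m.+1) v i * v (m.+2 - i)%N)
  - 3 / (2 * q) * (a ^+ m.+2 * (if odd m then 0 else u (m./2).+1)).
  have -> : m.+2%:R = m.+1%:R + 1 :> R by rewrite natr1.
  set S := \sum_(2 <= i < m.+1) _; set U := if _ then _ else _.
  rewrite [a ^+ m.+2]exprS; move: (a ^+ m.+1) m.+1%:R (v m.+1) a => X N V b.
  by field.
congr (_ + _ + _).
- have -> : a * 5 / (4 * q) = 1 by rewrite aE; field.
  by rewrite mul1r.
- congr (_ * _); rewrite mulr_sumr [LHS]big_add1/=; apply: eq_big_nat => i /andP[i1 im].
  rewrite /scaled_v [RHS]mulrACA -exprD.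
  have -> : (i.+1 + (m - i).+1 = m.+2)%N by lia.
  by rewrite !subSS subSn// ltnW.
- rewrite /riccati_source; case: ifPn => om; first by rewrite !mulr0 oppr0.
  rewrite /scaled_u doubleS (_ : (m./2).*2 = m)%N; last by lia.
  rewrite mulrN; congr (- _).
  have -> : q / 2 = (q * q) / (2 * q) by field.
  by rewrite qq.
Qed.

Lemma riccati_source_ge0 m : (0 < m)%N -> 0 <= rho m.
Proof.
move=> m0; rewrite /riccati_source; case: ifPn => // _.
have /andP[p0 _] := scaled_u_range (m./2).+1 isT.
by rewrite mulr_ge0// divr_ge0// ltW.
Qed.

(** For even [m] the source is at most [(j!)^2 / 25] with [2 j = m + 2], and such a
    product of factorials is smaller than any less balanced one. *)
Lemma riccati_source_le K m : (0 < m)%N -> (2 * K <= m + 2)%N ->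
  rho m <= (K`! * (m + 2 - K)`!)%:R / 25.
Proof.
move=> m0 Km; rewrite /riccati_source; case: ifPn => om; first by rewrite divr_ge0.
have /andP[p0 p1] := scaled_u_range (m./2).+1 isT.
have := @fact_mul_le K (m + 2) (m./2).+1 ltac:(lia) ltac:(lia).
rewrite (_ : m + 2 - (m./2).+1 = (m./2).+1)%N; last by lia.
rewrite -(ler_nat R) => h.
apply: (@le_trans _ _ (1 * p (m./2).+1)).
  by rewrite ler_wpM2r// ler_pdivrMr// mul1r.
by rewrite mul1r; apply: (le_trans p1); rewrite ler_wpM2r.
Qed.

Lemma riccati_coefficient_range : 0 <= kappa <= 3 / 4.
Proof.
apply/andP; split; first by rewrite divr_ge0// mulr_ge0// ltW.
by rewrite ler_pdivrMr ?mulr_gt0//; move: q_ge1; lra.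
Qed.

Lemma scaled_v1_range : 0 < y 1%N <= 1.
Proof. by rewrite scaled_v1; move: q0 q_le2 => h1 h2; apply/andP; split; lra. Qed.

Lemma scaled_nu_rec n : (0 < n)%N ->
  n%:R * mu n = - (2 * kappa) * \sum_(0 <= k < n) y (n - k)%N * mu k.
Proof.
move=> n0; have [_ nr] := hnu.
have n1 : n%:R != 0 :> R by rewrite pnatr_eq0; lia.
have -> : \sum_(0 <= k < n) y (n - k)%N * mu k =
    a ^+ n.+1 * \sum_(0 <= k < n) v (n.+1 - k)%N * nu k.
  rewrite mulr_sumr; apply: eq_big_nat => k /andP[_ kn].
  rewrite /scaled_v /scaled_nu mulrACA -exprD -subSn//; last by lia.
  by rewrite (_ : n.+1 - k + k = n.+1)%N//; lia.
rewrite /scaled_nu nr// exprS aE; field.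
by rewrite n1 qn0.
Qed.

Theorem scaled_v_expansion : exists2 C : R, 0 < C &
  forall L, fact_bigO R L.+1 (fun n =>
    y n - C * factorial_sum R mu L n).
Proof.
have [C C0 hC] := ratio_cvg R kappa y rho riccati_coefficient_range scaled_v1_range scaled_v_rec
  riccati_source_ge0 riccati_source_le.
exists C => // L.
apply: (factorial_expansion R kappa y rho riccati_coefficient_range scaled_v1_range scaled_v_rec
  riccati_source_ge0 riccati_source_le C mu hC _ scaled_nu_rec).
by rewrite /scaled_nu mul1r; case: hnu.
Qed.

(** The product of the [n + 1 - m] for [0 < m <= l] is [n! / (n-l)!]. *)
Lemma truncated_factorE L n : (L <= n)%N ->
  truncated_factor nu L n.+1 * n`!%:R =
  factorial_sum R mu L n.
Proof.
move=> Ln; rewrite /factorial_sum big_ltn// /truncated_factor mulrDl.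
have nf k : k`!%:R != 0 :> R by rewrite gt_eqF// ltr0n fact_gt0.
congr (_ + _).
  by have [nu0 _] := hnu; rewrite /scaled_nu nu0 expr0 subn0 !mul1r.
rewrite mulr_suml; apply: eq_big_nat => l /andP[l1 lL].
have -> : \prod_(1 <= m < l.+1) (n.+1%:R - m%:R) = n`!%:R / (n - l)`!%:R :> R.
  elim: l l1 lL => // -[|l] IH _ lL.
    have n0 : (0 < n)%N by lia.
    by rewrite big_nat1 -natrB// !subn1/= -{2}(prednK n0) factS natrM mulfK// prednK.
  rewrite big_nat_recr//= IH; [|by []|by lia].
  have -> : n.+1%:R - l.+2%:R = (n - l.+1)%:R :> R.
    by rewrite -natrB; [congr _%:R; lia | lia].
  have -> : (n - l.+1 = (n - l.+2).+1)%N by lia.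
  rewrite factS natrM; move: (pnatr_eq0 R (n - l.+2).+1) (nf (n - l.+2)%N).
  move: (n - l.+2).+1%:R (n - l.+2)`!%:R => X Y X0 Y0.
  by field; rewrite Y0 X0.
by rewrite /scaled_nu mulrC [nu l * _]mulrC; field; rewrite !nf.
Qed.

End PainleveOne.

(** Each of the [i] factors of [n! / (n-i)!] is at least [(n+1) / 2]. *)
Lemma fact_sub_mul_exp_le i n : (2 * i <= n.+1)%N ->
  ((n - i)`! * n.+1 ^ i <= 2 ^ i * n`!)%N.
Proof.
elim: i => [|i IH] h; first by rewrite subn0 mulnC.
apply: leq_trans (_ : 2 * ((n - i)`! * n.+1 ^ i) <= _)%N; last first.
  by rewrite expnS -mulnA leq_mul2l IH//; lia.
have -> : (n - i = (n - i.+1).+1)%N by lia.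
rewrite factS expnS mulnCA !mulnA leq_mul2r; apply/orP; right.
by rewrite leq_mul2r; apply/orP; right; lia.
Qed.

Lemma normc_ofreal (R : rcfType) (x : R) : `|x%:C| = `|x|%:C.
Proof. by rewrite normc_def /= expr0n addr0 sqrtr_sqr. Qed.

Section BigO.
Local Open Scope classical_set_scope.

Lemma bigO_ofreal (R : realType) (L : nat) (e : nat -> R) :
  (exists K : R, exists N : nat, forall n, (N <= n)%N -> `|e n| <= K * n%:R ^- L) ->
  (fun n => (e n)%:C : R[i]^o) =O_\oo (fun n : nat => n%:R ^- L : R[i]^o).
Proof.
move=> [K [N H]]; apply/eqO_exP.
exists (`|K| + 1)%:C.
  by rewrite ltcR ltr_wpDl.
exists N => // n /= Nn.
rewrite /= normc_ofreal.
have -> : `|(n%:R ^- L : R[i])| = (n%:R ^- L : R)%:C.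
  rewrite -[X in `|X|](_ : (n%:R ^- L : R)%:C = _); last first.
    by rewrite fmorphV rmorphXn/= rmorph_nat.
  by rewrite normc_ofreal ger0_norm// invr_ge0 exprn_ge0.
rewrite -rmorphM/= lecR; apply: le_trans (H n Nn) _.
rewrite ler_wpM2r ?invr_ge0 ?exprn_ge0//.
by apply: le_trans (ler_norm K) _; rewrite lerDl.
Qed.

End BigO.

Theorem theorem1 (R : realType) (u v nu : nat -> R)
    (hu : u_recursion u) (hv : v_recursion u v) (hnu : nu_recursion v nu) :
  exists S' : R[i], S' != 0 /\ asymptotic_expansion v nu S'.
Proof.
have [C C0 hC] := scaled_v_expansion R u v nu hu hv hnu.
have tpi : (2 * pi%:C * 'i%C : R[i]) != 0.
  rewrite !mulf_neq0 ?pnatr_eq0//.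
    by rewrite eq_complex /= negb_and gt_eqF ?pi_gt0.
  by rewrite eq_complex /= negb_and oner_eq0 orbT.
have C1 : C != 0 by rewrite gt_eqF.
have a0 : (bigA / 2 : R) != 0.
  by rewrite /bigA gt_eqF// !divr_gt0// mulr_gt0// sqrtr_gt0.
exists (C%:C * (2 * pi%:C * 'i%C)); split.
  by rewrite mulf_neq0// eq_complex /= negb_and C1.
move=> L; pose x n := v n / ((bigA / 2) ^- n * Gamma n%:R) / C - truncated_factor nu L n.
exists (fun n => (x n)%:C); split; last first.
  exists 1%N => // -[//|n] _ /=.
  have g0 : (n`!%:R : R) != 0 by rewrite gt_eqF// ltr0n fact_gt0.
  rewrite mulfK// -rmorphD/= -!rmorphM/= /x GammaS addrC subrK.
  congr _%:C; field.
  by rewrite g0 C1 expf_neq0.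
apply: bigO_ofreal.
have [M M0 [N H]] := fact_bigO_ge0 R _ _ (hC L).
exists (M * 2 ^+ L.+1 / C), (maxn N.+1 (2 * L.+1)) => -[|n]; first by rewrite geq_max.
rewrite geq_max => /andP[Nn Ln].
have g0 : 0 < (n`!%:R : R) by rewrite ltr0n fact_gt0.
have -> : x n.+1 = (scaled_v R v n -
    C * factorial_sum R (scaled_nu R nu) L n) / (C * n`!%:R).
  rewrite -(truncated_factorE R v nu hnu); last by lia.
  rewrite /x GammaS /scaled_v; field.
  by rewrite gt_eqF// C1 expf_neq0.
rewrite normrM normfV [`|C * _|]ger0_norm ?mulr_ge0 ?(ltW C0)//.
rewrite ler_pdivrMr ?mulr_gt0//.
apply: le_trans (H n _) _; first by lia.
have n0 : 0 < (n.+1%:R : R) ^+ L.+1 by rewrite exprn_gt0 ?ltr0n.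
have -> : M * 2 ^+ L.+1 / C * n.+1%:R ^- L.+1 * (C * n`!%:R) =
   M * (2 ^+ L.+1 * n`!%:R / n.+1%:R ^+ L.+1).
  by field; rewrite C1 gt_eqF.
rewrite ler_wpM2l// ler_pdivlMr//.
by rewrite -!natrX -!natrM ler_nat fact_sub_mul_exp_le.
Qed.
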